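(* Let $G$ be a graph. Then: (i) if $G$ is connected and not self-embeddable, then for all $n \ge 2$ we have $nG \in \mathcal{R}(G,nK_2)$, so that $\mathcal{R}(G,nK_2)$ is nonempty; (ii) if $G$ is strongly self-embeddable, then $\mathcal{R}(G,nK_2)$ is empty for all $n \ge 2$.
   Context: All graphs are simple, countable (finite or countably infinite), nonempty, and have no isolated vertices (so the given graphs have at least one edge), except that the vertex-deleted graph $G-v$ may have isolated vertices or be empty; collections of graphs are considered up to isomorphism. $nG$ is the disjoint union of $n$ copies of $G$; $nK_2$ is a matching with $n$ edges. A subgraph $H$ of $G$ has $V(H)\subseteq V(G)$ and $E(H)\subseteq E(G)$; it is proper if $E(H)$ is a proper subset of $E(G)$. An embedding $G\hookrightarrow H$ is an injective map $V(G)\to V(H)$ sending edges to edges. A graph is self-embeddable if it is isomorphic to one of its proper subgraphs. A graph $G$ is strongly self-embeddable if it admits an embedding into $G-v$ for every $v\in V(G)$. We write $F \to (G,H)$ if every red-blue coloring of the edges of $F$ produces a subgraph isomorphic to $G$ with all edges red or a subgraph isomorphic to $H$ with all edges blue. A graph $F$ is $(G,H)$-minimal if $F \to (G,H)$ and no proper subgraph $F'$ of $F$ satisfies $F' \to (G,H)$. $\mathcal{R}(G,H)$ denotes the collection of all $(G,H)$-minimal graphs. *)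

(* Defs.v *)
From Stdlib Require Import Relation_Operators.
From mathcomp Require Import all_boot.
From mathcomp Require Import boolp classical_sets functions cardinality.

Set Implicit Arguments.
Unset Strict Implicit.
Unset Printing Implicit Defensive.

Local Open Scope classical_set_scope.

(* A simple graph whose vertices are taken from an arbitrary ambient type [U];
   edges are two-element sets of vertices.  The empty graph and isolated
   vertices are allowed here, see [admissible]. *)
Record sgraph (U : Type) := SGraph {
  vertices : set U;
  edges : set (set U);
  edgesP : forall e, edges e ->
    exists x y, [/\ vertices x, vertices y, x <> y & e = [set x; y]] }.

Definition adj U (G : sgraph U) (x y : U) : Prop := edges G [set x; y].

(* The standing convention on graphs: countable (finite or infinite), nonempty
   and without isolated vertices. *)
Definition admissible U (G : sgraph U) : Prop :=
  [/\ countable (vertices G),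
      vertices G !=set0
    & forall x, vertices G x -> exists2 e, edges G e & e x].

Definition connected_graph U (G : sgraph U) : Prop :=
  forall x y, vertices G x -> vertices G y -> clos_refl_trans U (adj G) x y.

Definition subgraph U (H G : sgraph U) : Prop :=
  vertices H `<=` vertices G /\ edges H `<=` edges G.

(* Properness is about edges only. *)
Definition proper_subgraph U (H G : sgraph U) : Prop :=
  vertices H `<=` vertices G /\ edges H `<` edges G.

(* Only the values of [f] on [vertices G] are relevant, here and in
   [isomorphic]. *)
Definition embedding U W (G : sgraph U) (H : sgraph W) (f : U -> W) : Prop :=
  [/\ set_fun (vertices G) (vertices H) f,
      set_inj (vertices G) f
    & forall x y, adj G x y -> adj H (f x) (f y)].

Definition isomorphic U W (G : sgraph U) (H : sgraph W) : Prop :=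
  exists f : U -> W,
    set_bij (vertices G) (vertices H) f /\
    (forall x y, vertices G x -> vertices G y ->
       (adj G x y <-> adj H (f x) (f y))).

Definition self_embeddable U (G : sgraph U) : Prop :=
  exists H : sgraph U, proper_subgraph H G /\ isomorphic G H.

Section DelVertex.
Variables (U : Type) (G : sgraph U) (v : U).

Let dv_vertices : set U := [set x | vertices G x /\ x <> v].
Let dv_edges : set (set U) := [set e | edges G e /\ ~ e v].

Lemma del_vertex_subproof e : dv_edges e ->
  exists x y, [/\ dv_vertices x, dv_vertices y, x <> y & e = [set x; y]].
Proof.
move=> [/edgesP[x [y [Vx Vy xy ->]]] nev]; exists x, y; split => //.
- by split=> // xv; apply: nev; left.
- by split=> // yv; apply: nev; right.
Qed.

Definition del_vertex : sgraph U := SGraph del_vertex_subproof.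

End DelVertex.

Definition strongly_self_embeddable U (G : sgraph U) : Prop :=
  forall v, vertices G v -> exists f, embedding G (del_vertex G v) f.

Section Copies.
Variables (n : nat) (U : Type) (G : sgraph U).

Let nG_vertices : set (U * 'I_n) := [set p | vertices G p.1].
Let nG_edges : set (set (U * 'I_n)) :=
  [set e | exists (i : 'I_n) (e0 : set U),
     edges G e0 /\ e = (fun x => (x, i)) @` e0].

Lemma copies_subproof e : nG_edges e ->
  exists x y, [/\ nG_vertices x, nG_vertices y, x <> y & e = [set x; y]].
Proof.
move=> [i [e0 [/edgesP[x [y [Vx Vy xy ->]]] ->]]].
exists (x, i), (y, i); split => //; first by case.
by rewrite image_setU !image_set1.
Qed.

(* The disjoint union of [n] copies of [G]. *)
Definition copies : sgraph (U * 'I_n) := SGraph copies_subproof.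

End Copies.

Lemma K2_subproof (e : set bool) : [set [set: bool]] e ->
  exists x y, [/\ [set: bool] x, [set: bool] y, x <> y & e = [set x; y]].
Proof.
move=> ->; exists true, false; split => //.
by apply/seteqP; split=> // -[] _; [left | right].
Qed.

Definition K2 : sgraph bool := SGraph K2_subproof.

Variant color := Red | Blue.

Definition monochromatic W (c : set W -> color) (k : color) (H : sgraph W) :
  Prop := forall e, edges H e -> c e = k.

(* [F -> (G, H)]; only the values of [c] on [edges F] are relevant. *)
Definition arrows W (F : sgraph W) U (G : sgraph U) V (H : sgraph V) : Prop :=
  forall c : set W -> color,
    (exists G' : sgraph W,
       [/\ subgraph G' F, isomorphic G G' & monochromatic c Red G']) \/
    (exists H' : sgraph W,
       [/\ subgraph H' F, isomorphic H H' & monochromatic c Blue H']).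

(* Membership of (the isomorphism class of) [F] in R(G, H). *)
Definition ramsey_minimal U (G : sgraph U) V (H : sgraph V)
    W (F : sgraph W) : Prop :=
  [/\ admissible F,
      arrows F G H
    & forall F' : sgraph W, admissible F' -> proper_subgraph F' F ->
        ~ arrows F' G H].

Definition ramsey_nonempty U (G : sgraph U) V (H : sgraph V) : Prop :=
  exists (W : Type) (F : sgraph W), ramsey_minimal G H F.

(* Main.v *)
Require Import Defs.
From Stdlib Require Import Relation_Operators.
From mathcomp Require Import all_boot.
From mathcomp Require Import boolp classical_sets functions cardinality.

(** In (i), a 2-coloring of nG without red G has a blue edge in each copy, hence
    a blue nK_2.  For a proper subgraph F' of nG lacking the copy of an edge e0
    in the i0-th copy, color blue exactly the copies of e0: fewer than n blue
    edges remain, and a red G, being connected, lies in a single copy of G where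
    it avoids e0, contradicting that G is not self-embeddable.

    In (ii), iterating the strong self-embedding makes G embed into itself
    while avoiding any finite set of vertices.  So in any graph containing G and
    colored without red G, blue edges can be picked one at a time, each avoiding
    the previous ones.  Thus F -> (G, nK_2) as soon as F contains G, and F always
    properly contains another copy of G avoiding one vertex of the first one. *)

Set Implicit Arguments.
Unset Strict Implicit.
Unset Printing Implicit Defensive.

Local Open Scope classical_set_scope.

(** * Edges, and images of graphs under injections *)

Lemma image_set2 U W (f : U -> W) x y : f @` [set x; y] = [set f x; f y].
Proof. by rewrite image_setU !image_set1. Qed.

Lemma set_injP U W (A : set U) (f : U -> W) :
  set_inj A f <-> (forall x y, A x -> A y -> f x = f y -> x = y).
Proof.
split=> [inj x y Ax Ay | inj x y]; first by apply: inj; apply: mem_set.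
by move=> /set_mem Ax /set_mem Ay; apply: inj.
Qed.

Section Graphs.
Variables (U : Type) (G : sgraph U).

Lemma edge_vertices e x : edges G e -> e x -> vertices G x.
Proof. by move=> /edgesP[a [b [Va Vb _ ->]]] [] ->. Qed.

Lemma adj_vertices x y : adj G x y -> vertices G x /\ vertices G y.
Proof. by move=> Gxy; split; apply: edge_vertices Gxy _; [left|right]. Qed.

Lemma adj_neq x y : adj G x y -> x <> y.
Proof.
move=> /edgesP[a [b [_ _ ab E]]] xy; apply: ab; subst y.
have: [set x; x] a by rewrite E; left.
have: [set x; x] b by rewrite E; right.
by case=> ->; case=> ->.
Qed.

Lemma edge_adj e : edges G e -> exists x y, adj G x y /\ e = [set x; y].
Proof.
by move=> Ge; have [x [y [_ _ _ E]]] := edgesP Ge; exists x, y; rewrite /adj -E.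
Qed.

Section Image.
Variables (W : Type) (f : U -> W).
Hypothesis f_inj : set_inj (vertices G) f.

Lemma image_graph_subproof e : ((fun e0 => f @` e0) @` edges G) e ->
  exists x y, [/\ (f @` vertices G) x, (f @` vertices G) y, x <> y
                & e = [set x; y]].
Proof.
move=> [e0 /edgesP[x [y [Vx Vy xy ->]]] <-]; exists (f x), (f y).
split; [by exists x | by exists y | | exact: image_set2].
by move/(proj1 (set_injP _ _) f_inj x y Vx Vy).
Qed.

(** Turns an embedding into an actual subgraph of the host, the form in which [arrows] and
    [self_embeddable] ask for copies. *)
Definition image_graph : sgraph W := SGraph image_graph_subproof.

(** Only the reflection of adjacency needs work: an edge [e] with image [[set f x; f y]] must be
    [[set x; y]], by injectivity on the vertices. *)
Lemma isomorphic_image_graph : isomorphic G image_graph.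
Proof.
have inj := proj1 (set_injP _ _) f_inj.
exists f; split; first by split=> //; exact: imageP.
move=> x y Vx Vy; split=> [Gxy | [e Ge E]].
  by exists [set x; y]; rewrite ?image_set2.
rewrite /adj; suff <- : e = [set x; y] by [].
have sub z : e z -> [set x; y] z.
  move=> ez; have Vz := edge_vertices Ge ez.
  have: [set f x; f y] (f z) by rewrite -E; exists z.
  by case=> /(inj _ _ Vz) zE; [left | right]; apply: zE.
apply/seteqP; split=> // z xyz.
have [z' ez' fz] : (f @` e) (f z) by rewrite E; case: xyz => ->; [left|right].
have Vz : vertices G z by case: xyz => ->.
by rewrite -(inj z' z (edge_vertices Ge ez') Vz fz).
Qed.

Lemma image_graph_admissible : admissible G -> admissible image_graph.
Proof.
move=> [Vc [x0 Vx0] iso]; split.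
- exact: sub_countable (card_image_le _ _) Vc.
- by exists (f x0); exists x0.
- move=> _ [x Vx <-]; have [e Ge ex] := iso x Vx.
  by exists (f @` e); [exists e | exists x].
Qed.

End Image.

(** Converse passage, from a copy to an embedding. The last clause remembers that edges land in
    [G'], so that the color of [G'] can be used. *)
Lemma embedding_isomorphic W (F G' : sgraph W) :
  subgraph G' F -> isomorphic G G' ->
  exists f, [/\ embedding G F f, set_inj (vertices G) f
    & forall x y, adj G x y -> edges G' [set f x; f y]].
Proof.
move=> [subV subE] [f [[f_fun f_inj _] f_adj]].
have f_edge x y : adj G x y -> edges G' [set f x; f y].
  by move=> Gxy; have [Vx Vy] := adj_vertices Gxy; apply/f_adj.
exists f; split=> //; split=> // [x Vx | x y /f_edge]; last exact: subE.
exact/subV/f_fun.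
Qed.

Lemma image_graph_subgraph W (F : sgraph W) f (femb : embedding G F f)
  (f_inj : set_inj (vertices G) f) : subgraph (image_graph f_inj) F.
Proof.
case: femb => f_fun _ f_adj; split=> [_ [x Vx <-] | _ [e Ge <-]].
  exact: f_fun.
by have [x [y [Gxy ->]]] := edge_adj Ge; rewrite image_set2; apply: f_adj.
Qed.

End Graphs.

(** * Disjoint copies and matchings *)

Section Copies.
Variables (n : nat) (U : Type) (G : sgraph U).

Lemma copies_admissible : 0 < n -> admissible G -> admissible (copies n G).
Proof.
move=> n_gt0 [Vc [x0 Vx0] iso]; split.
- have := countableX Vc (countable_finpred (T := 'I_n) (fun=> true)).
  apply: sub_countable; apply: subset_card_le => -[x i] /= Vx.
  by split=> //=; apply/mem_set.
- by exists (x0, Ordinal n_gt0).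
- move=> [x i] /= Vx; have [e Ge ex] := iso x Vx.
  by exists ((fun y => (y, i)) @` e); [exists i, e | exists x].
Qed.

Lemma copies_adj x y : adj (copies n G) x y -> x.2 = y.2 /\ adj G x.1 y.1.
Proof.
move=> Gxy; have [a [b [_ _ ab E]]] := edgesP Gxy.
case: (Gxy) => i [e [/edge_adj[u [v [Guv ->]]] E']].
have xy := adj_neq Gxy; rewrite image_set2 in E'.
have: [set (u, i); (v, i)] x by rewrite -E'; left.
have: [set (u, i); (v, i)] y by rewrite -E'; right.
by move=> [] /= yE [] /= xE; move: xy; rewrite /adj yE xE //= setUC.
Qed.

End Copies.

Lemma copies_K2_edge n i : edges (copies n K2) [set (true, i); (false, i)].
Proof.
by exists i, [set: bool]; split=> //; rewrite setT_bool image_set2.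
Qed.

Lemma copies_K2_edgeP n e : edges (copies n K2) e ->
  exists i, e = [set (true, i); (false, i)].
Proof.
by move=> [i [_ [-> ->]]]; exists i; rewrite setT_bool image_set2.
Qed.

(** * Part (i): connected graphs that are not self-embeddable *)

Lemma not_red k : k <> Red -> k = Blue.
Proof. by case: k. Qed.

Lemma arrows_copies n U (G : sgraph U) : admissible G ->
  arrows (copies n G) G (copies n K2).
Proof.
move=> [_ [x0 Vx0] iso] c.
have copy_inj i : set_inj (vertices G) (fun x => (x, i) : U * 'I_n).
  by apply/set_injP => x y _ _ [].
have [red|] := pselect (exists i,
    monochromatic c Red (image_graph (copy_inj i))).
  left; have [i ired] := red; exists (image_graph (copy_inj i)).
  split=> //; last exact: isomorphic_image_graph.
  by split=> [_ [x Vx <-] //| _ [e Ge <-]]; exists i, e.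
move=> /forallNP noRed; right.
have /choice[p pP] i : exists p : U * U, adj G p.1 p.2 /\
    c [set (p.1, i); (p.2, i)] = Blue.
  have /existsNP[_ /not_implyP[[e Ge <-] /not_red]] := noRed i.
  by have [x [y [Gxy ->]]] := edge_adj Ge; rewrite image_set2; exists (x, y).
(* The edge number [i] of the matching goes to the blue edge chosen in copy [i]. *)
pose f (q : bool * 'I_n) := (if q.1 then (p q.2).1 else (p q.2).2, q.2).
have f_inj : set_inj (vertices (copies n K2)) f.
  apply/set_injP => -[b i] [b' j] _ _ [+ ij]; rewrite /= ij.
  have [jadj _] := pP j; have neq := adj_neq jadj.
  by case: b; case: b' => //= /esym.
exists (image_graph f_inj); split; last 2 first.
- exact: isomorphic_image_graph.
- move=> _ [_ /copies_K2_edgeP[i ->] <-].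
  by rewrite image_set2; have [] := pP i.
- split=> [_ [[b i] _ <-] | _ [_ /copies_K2_edgeP[i ->] <-]].
    by have [iadj _] := pP i; have [] := adj_vertices iadj; case: b.
  rewrite image_set2; exists i, [set (p i).1; (p i).2].
  by rewrite image_set2; have [] := pP i.
Qed.

(** If the image of [f] missed [e], it would be a proper subgraph isomorphic to [G]. *)
Lemma not_self_embeddable_edges U (G : sgraph U) (f : U -> U) e :
  ~ self_embeddable G -> embedding G G f -> edges G e ->
  exists2 e', edges G e' & f @` e' = e.
Proof.
move=> nG femb Ge; apply: contrapT => ne; apply: nG.
have f_inj : set_inj (vertices G) f by case: femb.
exists (image_graph f_inj); split; last exact: isomorphic_image_graph.
have [subV subE] := image_graph_subgraph femb f_inj.
by split=> //; split=> // /(_ e Ge)[e' Ge' e'E]; apply: ne; exists e'.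
Qed.

(** To be applied to the index of the copy in which a vertex lands. *)
Lemma connected_constant U V (G : sgraph U) (h : U -> V) :
  connected_graph G -> (forall x y, adj G x y -> h x = h y) ->
  forall x y, vertices G x -> vertices G y -> h x = h y.
Proof.
move=> conn hadj x y Vx Vy; by elim: (conn x y Vx Vy) => [//|//|a b d _ -> _ ->].
Qed.

Lemma not_arrows_proper n U (G : sgraph U) (F : sgraph (U * 'I_n)) :
  admissible G -> connected_graph G -> ~ self_embeddable G ->
  proper_subgraph F (copies n G) -> ~ arrows F G (copies n K2).
Proof.
move=> [_ [x0 Vx0] _] conn nself [subV [subE /existsNP[e1]]].
move=> /not_implyP[[i0 [e0 [Ge0 ->]]] nF] arr.
pose copy i : set (U * 'I_n) := (fun x => (x, i)) @` e0.
(* All [n] sets [copy i] are blue, but [copy i0] is not an edge of [F]. *)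
pose c e := if pselect (exists i, e = copy i) then Blue else Red.
have cB e : c e = Blue -> exists i, e = copy i by rewrite /c; case: pselect.
have cR i : c (copy i) = Blue by rewrite /c; case: pselect => // -[]; exists i.
case: (arr c) => -[H [HF GH mono]].
- have [f [[f_fun _ f_adj] f_inj f_E]] := embedding_isomorphic HF GH.
  have sndE u v : vertices G u -> vertices G v -> (f u).2 = (f v).2.
    apply: (connected_constant (h := fun u => (f u).2) conn) => a b.
    by move=> /f_adj /subE /copies_adj[].
  pose i := (f x0).2.
  have fE u : vertices G u -> f u = ((f u).1, i).
    by move=> Vu; rewrite /i (sndE x0 u) //; case: (f u).
  (* The red copy lies in copy [i], so forgetting the index gives a self-embedding of [G]. *)
  have gemb : embedding G G (fst \o f).
    split.
    + by move=> u /f_fun /subV.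
    + apply/set_injP => u v Vu Vv /= E.
      by apply: (proj1 (set_injP _ _) f_inj) => //; rewrite fE // E -fE.
    + by move=> u v /f_adj /subE /copies_adj[].
  (* This self-embedding reaches [e0], so the blue [copy i] is an edge of the red [H]. *)
  have [e' Ge' e'E] := not_self_embeddable_edges nself gemb Ge0.
  have [u [v [Guv e'uv]]] := edge_adj Ge'.
  have [Vu Vv] := adj_vertices Guv.
  have := cR i; rewrite /copy -e'E e'uv !image_set2 /= -!fE // mono //.
  exact: f_E.
- have [f [_ f_inj f_E]] := embedding_isomorphic HF GH.
  have HE (i : 'I_n) := f_E _ _ (copies_K2_edge i).
  (* The edges of a blue matching are disjoint, so [g] is injective, hence onto ['I_n]; it reaches
     [i0], which puts [copy i0] in [F]. *)
  have /choice[g gE] (i : 'I_n) := cB _ (mono _ (HE i)).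
  have g_inj : injective g.
    move=> i j ij.
    have : [set f (true, j); f (false, j)] (f (true, i)).
      by rewrite gE -ij -gE; left.
    by case=> /(proj1 (set_injP _ _) f_inj) => /(_ Logic.I Logic.I)[].
  have /codomP[i iE] := injF_onto g_inj i0.
  by apply: nF; rewrite iE -/(copy _) -gE; apply/(proj2 HF)/HE.
Qed.

(** * Part (ii): strongly self-embeddable graphs *)

Section StronglySelfEmbeddable.
Variables (U : Type) (G : sgraph U).
Hypothesis Gstrong : strongly_self_embeddable G.

Section Embedding.
Variables (W : Type) (F : sgraph W).

(** If [w] is [f v], precompose [f] with an embedding of [G] into [G - v]. The image only shrinks,
    so vertices avoided earlier stay avoided when this is iterated. *)
Lemma embedding_avoid1 f w : embedding G F f ->
  exists g, [/\ embedding G F g,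
    (forall x, vertices G x -> exists2 y, vertices G y & g x = f y)
    & forall x, vertices G x -> g x <> w].
Proof.
move=> femb; have [f_fun /set_injP f_inj f_adj] := femb.
have [[v Vv fv]|nw] := pselect (exists2 v, vertices G v & f v = w); last first.
  by exists f; split=> // x Vx; [exists x | move=> fx; apply: nw; exists x].
have [h [h_fun /set_injP h_inj h_adj]] := Gstrong Vv.
exists (f \o h); split.
- split=> [x /h_fun[Vhx _] | | x y /h_adj[Ghxy _]]; first exact: f_fun.
    apply/set_injP => x y Vx Vy fE; apply: h_inj => //.
    by apply: f_inj fE; [case: (h_fun x Vx) | case: (h_fun y Vy)].
  exact: f_adj.
- by move=> x /h_fun[Vhx _]; exists (h x).
- move=> x /h_fun[Vhx hxv] /= fE; apply: hxv; apply: f_inj => //.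
  by rewrite fE fv.
Qed.

Lemma embedding_avoid f m (w : nat -> W) : embedding G F f ->
  exists2 g, embedding G F g
    & forall i x, i < m -> vertices G x -> g x <> w i.
Proof.
move=> femb; elim: m => [|m [g gemb gw]]; first by exists f.
have [h [hemb hg hw]] := embedding_avoid1 (w m) gemb.
exists h => // i x; rewrite ltnS leq_eqVlt => /predU1P[-> | im] Vx.
  exact: hw.
by have [y Vy ->] := hg x Vx; apply: gw.
Qed.

(** Indexing by [nat] instead of ['I_m] lets the induction on [m] extend [M]; only its values below
    [m] matter. *)
Lemma blue_matching f (c : set W -> color) m :
    vertices G !=set0 -> embedding G F f ->
    (forall g (g_inj : set_inj (vertices G) g), embedding G F g ->
      ~ monochromatic c Red (image_graph g_inj)) ->
  exists M : nat -> bool -> W,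
    (forall i, i < m -> adj F (M i true) (M i false)
       /\ c [set M i true; M i false] = Blue) /\
    (forall i j b b', i < m -> j < m -> M i b = M j b' -> i = j /\ b = b').
Proof.
move=> [x0 _] femb nred; elim: m => [|m [M [Mblue Minj]]].
  by exists (fun _ _ => f x0).
(* The [m.*2] ends of the edges found so far are listed as one sequence: end [b] of edge [i] has
   index [b + i.*2]. *)
have [g gemb gM] := embedding_avoid m.*2 (fun k => M k./2 (odd k)) femb.
have {}gM i b x : i < m -> vertices G x -> g x <> M i b.
  move=> im Vx; have := gM (b + i.*2) x; rewrite half_bit_double oddD.
  rewrite odd_double addbF oddb; apply => //.
  by case: b; rewrite ?add0n ?ltn_double // add1n ltn_Sdouble.
have [_ g_inj g_adj] := gemb.
(* The image of [g] is not all red; any blue edge in it serves as edge number [m]. *)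
have /existsNP[_ /not_implyP[[e Ge <-] /not_red]] := nred g g_inj gemb.
have [x [y [Gxy ->]]] := edge_adj Ge; rewrite image_set2 => cxy.
have [Vx Vy] := adj_vertices Gxy.
pose N i b := if i == m then if b then g x else g y else M i b.
have NM i b : i < m -> N i b = M i b by rewrite /N; case: ltngtP.
have NgM i b b' : i < m -> N m b <> M i b'.
  by move=> im; rewrite /N eqxx; case: b; apply: gM.
have gxy : g x <> g y by apply/adj_neq/g_adj/Gxy.
exists N; split=> [i | i j b b'].
  rewrite ltnS leq_eqVlt => /predU1P[-> | im]; last first.
    by rewrite !NM //; apply: Mblue.
  by rewrite /N eqxx; split=> //; apply: g_adj.
rewrite !ltnS (leq_eqVlt i) (leq_eqVlt j).
move=> /predU1P[-> | im] /predU1P[-> | jm].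
- by rewrite /N eqxx; case: b; case: b' => // /esym.
- by rewrite (NM j) // => /NgM; case.
- by rewrite (NM i) // => /esym /NgM; case.
- by rewrite !NM //; apply: Minj.
Qed.

Lemma embedding_arrows n f : vertices G !=set0 -> embedding G F f ->
  arrows F G (copies n K2).
Proof.
move=> G0 femb c; apply: contrapT => /not_orP[nR]; apply.
have [|M [Mblue Minj]] := blue_matching (c := c) n G0 femb.
  move=> g g_inj gemb red; apply: nR; exists (image_graph g_inj); split=> //.
    exact: image_graph_subgraph.
  exact: isomorphic_image_graph.
pose h (p : bool * 'I_n) := M p.2 p.1.
have h_inj : set_inj (vertices (copies n K2)) h.
  apply/set_injP => -[b i] [b' j] _ _ ME.
  have [ij ->] := Minj i j b b' (ltn_ord i) (ltn_ord j) ME.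
  by congr pair; apply: val_inj.
exists (image_graph h_inj); split; last 2 first.
- exact: isomorphic_image_graph.
- move=> _ [_ /copies_K2_edgeP[i ->] <-]; rewrite image_set2.
  by have [] := Mblue i (ltn_ord i).
- apply: image_graph_subgraph; split=> // [[b i] _ | p q pq].
    have [iadj _] := Mblue i (ltn_ord i).
    by have [] := adj_vertices iadj; case: b.
  have [iadj _] := Mblue _ (ltn_ord q.2).
  have [pq2 _] := copies_adj pq; have := adj_neq pq.
  case: p q pq2 iadj {pq} => [b i] [b' j] /= -> iadj.
  by rewrite /h /adj /=; case: b; case: b' => //= _; rewrite setUC.
Qed.

End Embedding.

Lemma not_ramsey_nonempty n : admissible G -> 0 < n ->
  ~ ramsey_nonempty G (copies n K2).
Proof.
move=> admG n_gt0 [W [F [_ arr Fmin]]]; have [_ G0 iso] := admG.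
(* The all-red coloring shows that [F] contains a copy of [G], as the matching has an edge and
   cannot be blue. *)
case: (arr (fun=> Red)) => -[H [HF GH mono]]; last first.
  have [f [_ _ f_E]] := embedding_isomorphic HF GH.
  by have := mono _ (f_E _ _ (copies_K2_edge (Ordinal n_gt0))).
have [f [femb f_inj _]] := embedding_isomorphic HF GH.
have [x Vx] := G0; have [e Ge ex] := iso x Vx.
have [g [gemb _ gx]] := embedding_avoid1 (f x) femb.
have [_ g_inj _] := gemb.
have [subV subE] := image_graph_subgraph gemb g_inj.
apply: (Fmin (image_graph g_inj)); first exact: image_graph_admissible.
  split=> //; split=> // /(_ (f @` e)) [|e' Ge' e'E].
    exact/(proj2 (image_graph_subgraph femb f_inj))/imageP.
  have [y e'y] : (g @` e') (f x) by rewrite e'E; exists x.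
  by apply: gx; apply: edge_vertices Ge' e'y.
suff: embedding G (image_graph g_inj) g by apply: embedding_arrows.
split=> // [y Vy | y z Gyz]; first exact: imageP.
by rewrite /adj -image_set2; apply: imageP.
Qed.

End StronglySelfEmbeddable.

Theorem theorem16 (U : Type) (G : sgraph U) (admG : admissible G) :
  (connected_graph G -> ~ self_embeddable G ->
     forall n : nat, 2 <= n ->
       ramsey_minimal G (copies n K2) (copies n G) /\
       ramsey_nonempty G (copies n K2)) /\
  (strongly_self_embeddable G ->
     forall n : nat, 2 <= n -> ~ ramsey_nonempty G (copies n K2)).
Proof.
split=> [conn nself n n_ge2 | Gstrong n n_ge2]; last first.
  by apply: not_ramsey_nonempty => //; apply: ltnW.
suff nGmin : ramsey_minimal G (copies n K2) (copies n G).
  by split=> //; exists (U * 'I_n)%type, (copies n G).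
split; first by apply: copies_admissible => //; apply: ltnW.
  exact: arrows_copies.
by move=> F _; apply: not_arrows_proper.
Qed.
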